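(* Let $\kappa>0$, $0<\varepsilon<1$, $a=(1-\varepsilon)\kappa$, $b=(1+\varepsilon)\kappa$. In the experiment $Y\sim N(\mu,1)$, $\mu\in\mathbb R$, for measurable $\phi:\mathbb R\to[0,1]$ let $$R_\infty(\phi)=\sup_{|\mu|\le a}E_\mu\phi(Y)+\sup_{|\mu|\ge b}E_\mu\{1-\phi(Y)\},\qquad R_\infty^*(\kappa,\varepsilon)=\inf_\phi R_\infty(\phi).$$ Then there is a unique $c^*=c^*(\kappa,\varepsilon)>0$ satisfying $$e^{-b^2/2}\cosh(bc^* )=e^{-a^2/2}\cosh(ac^* ).$$ The rule $$\phi^*(Y)=\mathbf 1\{|Y|>c^*\}$$ is minimax, i.e. $R_\infty(\phi^* )=R_\infty^*(\kappa,\varepsilon)$, and $$R_\infty^*(\kappa,\varepsilon)=\Phi(a-c^* )+\Phi(-a-c^* )+\Phi(c^*-b)-\Phi(-c^*-b).$$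
   Context: $\Phi$ is the standard normal distribution function; $E_\mu$ is expectation under $Y\sim N(\mu,1)$. *)

(* Defs.v *)
From HB Require Import structures.
From mathcomp Require Import all_boot all_order all_algebra.
From mathcomp Require Import all_classical all_reals all_analysis.
Set Implicit Arguments.
Unset Strict Implicit.
Unset Printing Implicit Defensive.
Import Order.TTheory GRing.Theory Num.Theory.
Import numFieldNormedType.Exports.
Local Open Scope classical_set_scope.
Local Open Scope ring_scope.

Definition cosh {R : realType} (x : R) : R := (expR x + expR (- x)) / 2.

Definition Phi {R : realType} (x : R) : R :=
  fine (normal_prob (0 : R) 1 `]-oo, x]).

Definition is_test {R : realType} (phi : R -> R) : Prop :=
  measurable_fun [set: R] phi /\ forall y, 0 <= phi y <= 1.

(* The experiment is canonical: Y is the identity on R under [normal_prob mu 1],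
   the second parameter of [normal_prob] being the standard deviation. *)
Definition Rinf {R : realType} (a b : R) (phi : R -> R) : \bar R :=
  (ereal_sup [set 'E_(normal_prob mu 1)[phi] | mu in [set mu : R | `|mu| <= a]%R] +
   ereal_sup [set 'E_(normal_prob mu 1)[(fun y => 1 - phi y)%R]
             | mu in [set mu : R | b <= `|mu|]%R])%E.

Definition Rinf_star {R : realType} (kappa eps : R) : \bar R :=
  ereal_inf [set Rinf ((1 - eps) * kappa) ((1 + eps) * kappa) phi
            | phi in [set phi : R -> R | is_test phi]].

Definition threshold_test {R : realType} (c y : R) : R :=
  if c < `|y| then 1 else 0.

Definition is_minimax {R : realType} (kappa eps : R) (phi : R -> R) : Prop :=
  is_test phi /\
  Rinf ((1 - eps) * kappa) ((1 + eps) * kappa) phi = Rinf_star kappa eps.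

(* Main.v *)
Require Import Defs.
From mathcomp Require Import all_boot all_order all_algebra.
From mathcomp Require Import all_classical all_reals all_analysis.
From mathcomp Require Import measurable_realfun ring lra.
Import Order.TTheory GRing.Theory Num.Theory.
Import numFieldNormedType.Exports.
Local Open Scope classical_set_scope.
Local Open Scope ring_scope.

(* For 0 <= a < b the ratio cosh(b y) / cosh(a y) is strictly increasing in
   |y|, so the symmetric mixtures of N(a,1), N(-a,1) and of N(b,1), N(-b,1) have
   likelihoods that cross at a single value c of |y|. By Neyman-Pearson the test
   1{|y| > c} minimises the Bayes risk between these two mixtures, a lower bound
   for the worst case risk of any test. Single crossing also makes the power of
   every threshold test nondecreasing in |m|, so its worst case risk is attained
   at a and b and coincides with that Bayes risk. *)

(** * Hyperbolic cosine inequalities and the crossing of the mixture likelihood ratios *)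

Section hyperbolic.
Context {R : realType}.
Implicit Types a b x y m : R.

Lemma cosh_gt0 x : 0 < cosh x.
Proof. by rewrite divr_gt0// addr_gt0// expR_gt0. Qed.

Lemma coshN x : cosh (- x) = cosh x.
Proof. by rewrite /cosh opprK addrC. Qed.

Lemma cosh_norm x : cosh `|x| = cosh x.
Proof. by case: ger0P => // _; rewrite coshN. Qed.

(** Once [x] is replaced by its absolute value, twice the difference factors as (e^y - e^x)(1 -
    e^(-x-y)), and both factors are positive. *)
Lemma ltr_cosh x y : `|x| < y -> cosh x < cosh y.
Proof.
rewrite -(cosh_norm x); move: `|x| (normr_ge0 x) => {}x x0 xy.
rewrite /cosh ltr_pM2r// -subr_gt0.
have -> : expR y + expR (- y) - (expR x + expR (- x)) =
    (expR y - expR x) * (1 - expR (- x) * expR (- y)).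
  have ex : expR x * expR (- x) = 1 by rewrite expRN divff ?gt_eqF ?expR_gt0.
  have ey : expR y * expR (- y) = 1 by rewrite expRN divff ?gt_eqF ?expR_gt0.
  by ring: ex ey.
by rewrite mulr_gt0// subr_gt0 ?ltr_expR// -expRD expR_lt1; lra.
Qed.

Lemma cosh_prod x y : cosh x * cosh y = (cosh (x + y) + cosh (x - y)) / 2.
Proof. by rewrite /cosh !opprD !opprK !expRD; field. Qed.

(** The product formula reduces this to bx + ay < by + ax and |bx - ay| < by - ax, whose gaps are
    products of sums and differences of [a], [b] and of [x], [y]. *)
Lemma cosh_cross a b x y : 0 <= a -> a < b -> 0 <= x -> x < y ->
  cosh (b * x) * cosh (a * y) < cosh (b * y) * cosh (a * x).
Proof.
move=> a0 ab x0 xy; rewrite !cosh_prod ltr_pM2r// ltrD// ltr_cosh//.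
  rewrite ger0_norm; first by nra.
  by rewrite addr_ge0 ?mulr_ge0//; lra.
by rewrite ltr_norml; apply/andP; split; nra.
Qed.

(* Likelihood ratio at y of the symmetric mixture of N(m,1) and N(-m,1)
   against N(0,1). *)
Definition mixture_lr m y := expR (- m ^+ 2 / 2) * cosh (m * y).

Lemma mixture_lr_norm m y : mixture_lr m `|y| = mixture_lr m y.
Proof.
rewrite /mixture_lr -[in RHS]cosh_norm normrM.
by rewrite -[in LHS]cosh_norm normrM normr_id.
Qed.

Lemma mixture_lr_cross a b x y : 0 <= a -> a < b -> 0 <= x -> x < y ->
  mixture_lr a x <= mixture_lr b x -> mixture_lr a y < mixture_lr b y.
Proof.
rewrite /mixture_lr => a0 ab x0 xy le_x.
rewrite -(ltr_pM2r (cosh_gt0 (a * x))).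
have := ler_pM2r (cosh_gt0 (a * y)) (expR (- a ^+ 2 / 2) * cosh (a * x))
  (expR (- b ^+ 2 / 2) * cosh (b * x)).
rewrite le_x => le_xy.
apply: (@le_lt_trans _ _ (expR (- b ^+ 2 / 2) * cosh (b * x) * cosh (a * y))).
  by rewrite mulrAC.
by rewrite -!(mulrA _ (cosh _)) ltr_pM2l ?expR_gt0//; exact: cosh_cross.
Qed.

Lemma continuous_mixture_lr m : continuous (mixture_lr m).
Proof.
move=> y; apply: cvgM; first exact: cvg_cst.
apply: cvgM; last exact: cvg_cst.
have my : (fun z : R => m * z) @ y --> m * y.
  by apply: cvgM; [exact: cvg_cst|exact: cvg_id].
apply: cvgD; apply: continuous_cvg; [exact: continuous_expR|exact: my| |].
  exact: continuous_expR.
exact: cvgN.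
Qed.

Lemma mixture_lr_eq a b : 0 <= a -> a < b ->
  exists2 c, 0 < c & mixture_lr b c = mixture_lr a c.
Proof.
move=> a0 ab.
pose f := fun y => mixture_lr b y - mixture_lr a y.
(* [M] solves e^(-a^2/2) e^(aM) = e^(-b^2/2) e^(bM) / 2, where the upper bound cosh(aM) <= e^(aM)
   meets the lower bound e^(bM)/2 <= cosh(bM). *)
pose M := (ln 2 + (b ^+ 2 - a ^+ 2) / 2) / (b - a).
have M0 : 0 <= M.
  have : 0 <= ln (2 : R) by rewrite ln_ge0// ler1n.
  by move=> ?; rewrite divr_ge0//; nra.
have f0 : f 0 < 0.
  rewrite /f /mixture_lr !mulr0 subr_lt0 ltr_pM2r ?cosh_gt0// ltr_expR.
  by nra.
have fM : 0 <= f M.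
  rewrite subr_ge0; apply: (@le_trans _ _ (expR (- a ^+ 2 / 2) * expR (a * M))).
    rewrite ler_pM2l ?expR_gt0// /cosh ler_pdivrMr// mulr_natr mulr2n lerD2l.
    by rewrite ler_expR; nra.
  apply: (@le_trans _ _ (expR (- b ^+ 2 / 2) * (expR (b * M) / 2))); last first.
    by rewrite ler_pM2l ?expR_gt0// ler_pM2r// lerDl expR_ge0.
  rewrite mulrA ler_pdivlMr// -[X in _ * X](@lnK R 2) ?posrE// -!expRD ler_expR.
  have -> : b * M = a * M + (ln 2 + (b ^+ 2 - a ^+ 2) / 2).
    by rewrite /M; field; rewrite gt_eqF// subr_gt0.
  by lra.
have cf : {within `[0, M], continuous f}.
  apply: continuous_subspaceT => y.
  by apply: cvgB; exact: continuous_mixture_lr.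
have sf : Num.min (f 0) (f M) <= 0 <= Num.max (f 0) (f M).
  by rewrite ge_min le_max (ltW f0) fM orbT.
have [c + fc] := IVT M0 cf sf.
rewrite in_itv/= => /andP[c0 _]; exists c; last first.
  by apply/eqP; rewrite -subr_eq0; apply/eqP.
rewrite lt_neqAle c0 andbT; apply/eqP => c0'.
by move: fc f0; rewrite -c0' => ->; rewrite ltxx.
Qed.

End hyperbolic.

(** * Normal integrals, powers of tests and the Neyman-Pearson inequality *)

Section normal_integration.
Context {R : realType}.
Local Notation leb := (@lebesgue_measure R).
Implicit Types (m s t x y : R) (phi psi : R -> R).

(* Both sides are determined by the density, which by uniqueness is the
   Radon-Nikodym derivative almost everywhere. *)
Lemma integral_normal_prob m s (f : R -> \bar R) :
  (normal_prob m s).-integrable setT f ->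
  (\int[normal_prob m s]_y f y = \int[leb]_y (f y * (normal_pdf m s y)%:E))%E.
Proof.
move=> intf; have dom := normal_prob_dominates m s.
rewrite -(Radon_Nikodym_change_of_variables dom)//=.
apply: ae_eq_integral => //.
- apply: emeasurable_funM; first exact: measurable_int intf.
  by apply: (measurable_int leb); exact: Radon_Nikodym_integrable.
- apply: emeasurable_funM; first exact: measurable_int intf.
  by apply/measurable_EFinP; exact: measurable_normal_pdf.
- apply: ae_eqe_mul2l; rewrite Radon_NikodymE//=.
  case: cid => /= h [h1 h2 h3].
  apply: integral_ae_eq => //=.
  + by apply/measurable_EFinP; exact: measurable_normal_pdf.
  + by move=> E _ mE; rewrite -h3.
Qed.

Lemma measurable_reflect t :
  measurable_fun setT ((fun y => t - y) : R -> measurableTypeR R).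
Proof. exact: measurable_funB. Qed.

Lemma lebesgue_measure_reflect t (A : set R) : measurable A ->
  pushforward leb ((fun y => t - y) : _ -> measurableTypeR R) A = leb A.
Proof.
move=> mA; apply/esym/lebesgue_measure_unique => //=.
  exact: measurable_reflect.
move=> _ _ [[a b]] _ <-.
(* Reflection moves the closed endpoint to the other side but keeps the length. *)
have preim : ((fun y => t - y) @^-1` [set` `]a, b]]) = [set` `[t - b, t - a[].
  by apply/seteqP; split=> y /=; rewrite !in_itv/= => /andP[? ?];
    apply/andP; split; lra.
rewrite /pushforward preim !lebesgue_measure_itv/=.
by rewrite !lte_fin ltrD2l ltrN2; case: ifP => // _; congr EFin; ring.
Qed.

Lemma normal_pdf_reflect m s t y : s != 0 ->
  normal_pdf m s (t - y) = normal_pdf (t - m) s y.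
Proof.
move=> s0; rewrite !normal_pdfE// /normal_fun.
by have -> : (t - y - m) ^+ 2 = (y - (t - m)) ^+ 2 by ring.
Qed.

(** Change of variables under a reflection, which preserves Lebesgue measure. Taking t = m turns
    upper tails into standard lower tails; t = 0 exchanges the means m and -m. *)
Lemma normal_prob_reflect m s t (A : set R) : s != 0 -> measurable A ->
  normal_prob m s A = normal_prob (t - m) s ((fun y => t - y) @^-1` A).
Proof.
move=> s0 mA; rewrite /normal_prob.
transitivity (\int[pushforward leb ((fun y => (t - y)%R)
    : R -> measurableTypeR R)]_(y in A) (normal_pdf m s y)%:E)%E.
  apply: eq_measure_integral; first exact: measurable_reflect.
  by move=> ? B mB _; apply/esym/lebesgue_measure_reflect.
rewrite ge0_integral_pushforward; first last.
- by move=> y _; rewrite lee_fin normal_pdf_ge0.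
- by apply/measurable_EFinP/measurable_funTS; exact: measurable_normal_pdf.
- exact: mA.
- exact: measurable_reflect.
by apply: eq_integral => y _ /=; rewrite normal_pdf_reflect.
Qed.

Lemma normal_prob_Iio m x :
  normal_prob m 1 `]-oo, x[ = normal_prob m 1 `]-oo, x].
Proof.
rewrite /normal_prob integral_itv_bndo_bndc//.
by apply/measurable_EFinP/measurable_funTS; exact: measurable_normal_pdf.
Qed.

Lemma PhiE x : normal_prob 0 1 `]-oo, x] = (Phi x)%:E.
Proof. by rewrite fineK// fin_num_measure. Qed.

Lemma normal_prob_Ioi m x : normal_prob m 1 `]x, +oo[ = (Phi (m - x))%:E.
Proof.
rewrite (@normal_prob_reflect _ _ m) ?oner_neq0// subrr -PhiE -normal_prob_Iio.
by congr normal_prob; apply/seteqP; split=> y /=; rewrite !in_itv/=; lra.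
Qed.

Lemma PhiN x : Phi (- x) = 1 - Phi x.
Proof.
apply: EFin_inj; rewrite -[- x]add0r -normal_prob_Ioi EFinB -PhiE.
by rewrite -probability_setC// setCitvl.
Qed.

Lemma threshold_testE c : 0 <= c ->
  threshold_test c = \1_(`]-oo, - c[ `|` `]c, +oo[) :> (R -> R).
Proof.
move=> c0; apply/funext => y; rewrite /threshold_test indicE.
have -> : (y \in `]-oo, - c[ `|` `]c, +oo[) = (c < `|y|) :> bool.
  rewrite in_setU !mem_setE !in_itv/= andbT.
  by rewrite ltr_normr orbC [c < - y]ltrNr.
by case: ifP.
Qed.

Lemma threshold_test_is_test c : 0 <= c -> is_test (threshold_test c : R -> R).
Proof.
move=> c0; split; last first.
  by move=> y; rewrite /threshold_test; case: ifP; rewrite lexx ler01.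
by rewrite threshold_testE//; apply: measurable_indic; exact: measurableU.
Qed.

(** Real-valued so that ring and linear arithmetic apply; for a test the expectation is finite, so
    [fine] loses nothing. *)
Definition power m phi : R := fine 'E_(normal_prob m 1)[phi].

Lemma power_threshold c m : 0 <= c ->
  power m (threshold_test c) = Phi (m - c) + Phi (- m - c).
Proof.
move=> c0; rewrite /power threshold_testE// expectation_indic; last first.
  exact: measurableU.
rewrite measureU//; last first.
  by apply/seteqP; split=> y //= []; rewrite !in_itv/=; lra.
transitivity (fine ((Phi (- m - c))%:E + (Phi (m - c))%:E)); last exact: addrC.
congr (fine (_ + _)); last exact: normal_prob_Ioi.
rewrite -normal_prob_Ioi.
(* The left ray under mean [m] becomes the right ray under mean [- m]. *)
rewrite [LHS](normal_prob_reflect _ 1 0 _ (oner_neq0 R) (measurable_itv _)) sub0r.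
by congr normal_prob; apply/seteqP; split=> y /=; rewrite !in_itv/=; lra.
Qed.

Lemma is_test_cst (r : R) : 0 <= r <= 1 -> is_test (cst r).
Proof. by move=> r01; split. Qed.

Lemma power_cst (r : R) m : power m (cst r) = r.
Proof. by rewrite /power expectation_cst. Qed.

Lemma integrable_test m phi : is_test phi ->
  (normal_prob m 1).-integrable setT (EFin \o phi).
Proof.
move=> [mphi phi01]; apply: (@le_integrable _ _ _ _ _ _ _ (cst 1%E)) => //.
- exact/measurable_EFinP.
- move=> y _ /=; have /andP[? ?] := phi01 y.
  by rewrite normr1 lee_fin ger0_norm.
- exact: finite_measure_integrable_cst.
Qed.

Lemma expectation_test m phi : is_test phi ->
  ('E_(normal_prob m 1)[phi] = (power m phi)%:E)%E.
Proof.
move=> tphi; rewrite fineK// unlock.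
by apply: integrable_fin_num => //; exact: integrable_test.
Qed.

Lemma expectation_test_onem m phi : is_test phi ->
  ('E_(normal_prob m 1)[(fun y => 1 - phi y)%R] = (1 - power m phi)%R%:E)%E.
Proof.
move=> tphi; rewrite EFinB -(expectation_test m phi tphi).
rewrite -(expectation_cst (normal_prob m 1) 1) unlock.
rewrite -integralB_EFin//; first exact: finite_measure_integrable_cst.
exact: integrable_test.
Qed.

Lemma integrable_test_pdf m phi : is_test phi ->
  leb.-integrable setT (EFin \o (fun y => phi y * normal_pdf m 1 y)).
Proof.
move=> [mphi phi01].
apply: le_integrable (integrable_normal_pdf m 1) => //.
- apply/measurable_EFinP; apply: measurable_funM => //.
  exact: measurable_normal_pdf.
- move=> y _ /=; have /andP[? ?] := phi01 y.
  by rewrite lee_fin normrM ger0_norm// ler_piMl.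
Qed.

Lemma powerE m phi : is_test phi ->
  power m phi = \int[leb]_y (phi y * normal_pdf m 1 y).
Proof.
move=> tphi; rewrite /power unlock /Rintegral integral_normal_prob//.
exact: integrable_test.
Qed.

(** Expanding the squares splits off the common factor e^(-y^2/2) e^(-m^2/2) and leaves e^(my) +
    e^(-my). *)
Lemma normal_pdf_mixture m y :
  normal_pdf m 1 y + normal_pdf (- m) 1 y =
  2 * normal_pdf 0 1 y * mixture_lr m y.
Proof.
rewrite !normal_pdfE ?oner_neq0// /normal_fun /mixture_lr /cosh.
set K := normal_peak 1.
have -> : - (y - m) ^+ 2 / (1 ^+ 2 *+ 2) =
    - (y - 0) ^+ 2 / (1 ^+ 2 *+ 2) + - m ^+ 2 / 2 + m * y by field.
have -> : - (y - - m) ^+ 2 / (1 ^+ 2 *+ 2) =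
    - (y - 0) ^+ 2 / (1 ^+ 2 *+ 2) + - m ^+ 2 / 2 + - (m * y) by field.
rewrite !(expRD _ (m * y)) !(expRD _ (- (m * y))) !(expRD _ (- m ^+ 2 / 2)).
by field.
Qed.

Lemma neyman_pearson_mixture a b phi psi : is_test phi -> is_test psi ->
  (forall y, 0 <= (psi y - phi y) * (mixture_lr b y - mixture_lr a y)) ->
  (power b phi + power (- b) phi) - (power a phi + power (- a) phi) <=
  (power b psi + power (- b) psi) - (power a psi + power (- a) psi).
Proof.
(* Negative terms change sides, so that each side is a sum of four integrals and the integrands can
   be compared pointwise. *)
move=> tphi tpsi sgn; rewrite lerBlDr addrAC lerBrDr.
have itf m := integrable_test_pdf m phi tphi.
have its m := integrable_test_pdf m psi tpsi.
have intD4 f1 f2 f3 f4 : leb.-integrable setT (EFin \o f1) ->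
    leb.-integrable setT (EFin \o f2) -> leb.-integrable setT (EFin \o f3) ->
    leb.-integrable setT (EFin \o f4) ->
    leb.-integrable setT (EFin \o (fun y => f1 y + f2 y + (f3 y + f4 y))) /\
    \int[leb]_y f1 y + \int[leb]_y f2 y + (\int[leb]_y f3 y + \int[leb]_y f4 y)
    = \int[leb]_y (f1 y + f2 y + (f3 y + f4 y)).
  move=> i1 i2 i3 i4.
  have i12 : leb.-integrable setT (EFin \o (fun y => f1 y + f2 y)).
    exact: integrableD i1 i2.
  have i34 : leb.-integrable setT (EFin \o (fun y => f3 y + f4 y)).
    exact: integrableD i3 i4.
  split; first exact: integrableD i12 i34.
  by rewrite RintegralD// !RintegralD.
rewrite !powerE//.
have [iL ->] := intD4 _ _ _ _ (itf b) (itf (- b)) (its a) (its (- a)).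
have [iR ->] := intD4 _ _ _ _ (its b) (its (- b)) (itf a) (itf (- a)).
apply: le_Rintegral => // y _.
rewrite -!mulrDr !normal_pdf_mixture -subr_ge0.
set p := normal_pdf 0 1 y.
have -> : psi y * (2 * p * mixture_lr b y) + phi y * (2 * p * mixture_lr a y)
  - (phi y * (2 * p * mixture_lr b y) + psi y * (2 * p * mixture_lr a y))
  = 2 * p * ((psi y - phi y) * (mixture_lr b y - mixture_lr a y)) by ring.
by rewrite mulr_ge0// mulr_ge0// normal_pdf_ge0.
Qed.

End normal_integration.

(** * Monotone power and minimaxity of threshold tests *)

Section threshold_optimality.
Context {R : realType}.
Implicit Types (a b c m y : R) (phi : R -> R).

Lemma mixture_lr_above a b c y : 0 <= a -> a < b -> 0 <= c ->
  mixture_lr a c <= mixture_lr b c -> c < `|y| ->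
  mixture_lr a y <= mixture_lr b y.
Proof.
move=> a0 ab c0 le_c cy; rewrite -(mixture_lr_norm a) -(mixture_lr_norm b).
by apply/ltW/(mixture_lr_cross _ _ c).
Qed.

(** Contrapositive of the crossing: were the [b] curve above at some |y| < c, it would be strictly
    above at [c]. *)
Lemma mixture_lr_below a b c y : 0 <= a -> a < b ->
  mixture_lr b c <= mixture_lr a c -> `|y| <= c ->
  mixture_lr b y <= mixture_lr a y.
Proof.
move=> a0 ab le_c; rewrite -(mixture_lr_norm a y) -(mixture_lr_norm b y).
rewrite le_eqVlt => /predU1P[-> //|yc].
rewrite leNgt; apply: contraTN le_c => /ltW.
by rewrite -ltNge; apply: mixture_lr_cross.
Qed.

Lemma power_thresholdN c m : 0 <= c ->
  power (- m) (threshold_test c) = power m (threshold_test c).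
Proof. by move=> c0; rewrite !power_threshold// opprK addrC. Qed.

Lemma power_threshold_norm c m : 0 <= c ->
  power `|m| (threshold_test c) = power m (threshold_test c).
Proof. by move=> c0; case: ger0P => _; rewrite ?power_thresholdN. Qed.

(* The difference of two mixture likelihoods changes sign only once, so the
   threshold test beats one of the two trivial tests. *)
Lemma power_threshold_le c m1 m2 : 0 <= c -> `|m1| <= `|m2| ->
  power m1 (threshold_test c) <= power m2 (threshold_test c).
Proof.
move=> c0.
rewrite -(power_threshold_norm c m1 c0) -(power_threshold_norm c m2 c0).
move: `|m1| `|m2| (normr_ge0 m1) => {m1}a {m2}b.
move=> a0; rewrite le_eqVlt => /predU1P[-> //|ab].
have cstT (r : R) : 0 <= r <= 1 ->
    (forall y,
      0 <= (threshold_test c y - r) * (mixture_lr b y - mixture_lr a y)) ->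
    power a (threshold_test c) <= power b (threshold_test c).
  move=> r01 sgn.
  (* A constant test has equal power at all means, so one side vanishes; by evenness the other is
     twice the gain in power from [a] to [b]. *)
  have := neyman_pearson_mixture a b _ _ (is_test_cst r r01)
    (threshold_test_is_test c c0) sgn.
  rewrite !power_cst !(power_thresholdN c _ c0).
  by move: (power a _) (power b _) => p q; lra.
(* Either the [b] mixture dominates on the whole rejection region, and the competitor is 0, or the
   [a] mixture dominates on the whole acceptance region, and the competitor is 1. *)
have [le_c|/ltW le_c] := leP (mixture_lr a c) (mixture_lr b c).
- apply: (cstT 0) => [|y]; first by rewrite lexx ler01.
  rewrite /threshold_test; case: ifPn => [cy|_]; last by rewrite subrr mul0r.
  by rewrite subr0 mul1r subr_ge0; exact: mixture_lr_above cy.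
- apply: (cstT 1) => [|y]; first by rewrite lexx ler01.
  rewrite /threshold_test; case: ifPn => [_|]; first by rewrite subrr mul0r.
  rewrite -leNgt sub0r mulN1r opprB subr_ge0 => yc.
  exact: mixture_lr_below yc.
Qed.

(** Power is nondecreasing in the absolute mean, so the suprema are attained at the boundary means
    [a] and [b]. *)
Lemma Rinf_threshold a b c : 0 <= a -> 0 <= b -> 0 <= c ->
  Rinf a b (threshold_test c) =
  (power a (threshold_test c) + (1 - power b (threshold_test c)))%:E.
Proof.
move=> a0 b0 c0; have tT := threshold_test_is_test c c0.
rewrite /Rinf EFinD.
congr (_ + _)%E; apply/eqP; rewrite eq_le; apply/andP; split.
- apply: ge_ereal_sup => _ [m /= ma <-].
  rewrite (expectation_test _ _ tT) lee_fin; apply: power_threshold_le => //.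
  by rewrite (ger0_norm a0).
- apply: ereal_sup_ubound; exists a; last exact: expectation_test.
  by rewrite /= ger0_norm.
- apply: ge_ereal_sup => _ [m /= mb <-].
  rewrite (expectation_test_onem _ _ tT) lee_fin lerD2l lerN2.
  by apply: power_threshold_le => //; rewrite (ger0_norm b0).
- apply: ereal_sup_ubound; exists b; last exact: expectation_test_onem.
  by rewrite /= ger0_norm.
Qed.

Lemma ereal_sup_ge_mean (S : set (\bar R)) (u v : R) :
  S u%:E -> S v%:E -> (((u + v) / 2)%:E <= ereal_sup S)%E.
Proof.
move=> Su Sv; have [uv|/ltW vu] := leP u v.
- by apply: (le_trans _ (ereal_sup_ubound Sv)); rewrite lee_fin; lra.
- by apply: (le_trans _ (ereal_sup_ubound Su)); rewrite lee_fin; lra.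
Qed.

(* The worst case risk dominates the Bayes risk for the uniform priors on
   {-a, a} and {-b, b}, which the threshold test minimises. *)
Lemma Rinf_threshold_le a b c phi : 0 <= a -> a < b -> 0 <= c ->
  mixture_lr b c = mixture_lr a c -> is_test phi ->
  (Rinf a b (threshold_test c) <= Rinf a b phi)%E.
Proof.
move=> a0 ab c0 eq_c tphi; have b0 : 0 <= b by lra.
have tT := threshold_test_is_test c c0.
have sgn y :
    0 <= (threshold_test c y - phi y) * (mixture_lr b y - mixture_lr a y).
  have /andP[phi0 phi1] := tphi.2 y.
  rewrite /threshold_test; case: ifPn => [cy|].
    rewrite mulr_ge0 ?subr_ge0//; apply: mixture_lr_above cy => //.
    by rewrite eq_c.
  rewrite -leNgt => yc; rewrite mulr_le0 ?subr_le0//.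
  by apply: mixture_lr_below yc => //; rewrite eq_c.
have := neyman_pearson_mixture a b _ _ tphi tT sgn.
rewrite !(power_thresholdN c _ c0) => NP.
rewrite Rinf_threshold//.
(* The middle term is the Bayes risk of [phi]; half of [NP] bounds it from below. *)
apply: (@le_trans _ _ (((power a phi + power (- a) phi) / 2)%:E +
    ((1 - power b phi + (1 - power (- b) phi)) / 2)%:E)%E).
  rewrite -EFinD lee_fin; move: NP.
  by do ![move: (power _ _) => ?]; lra.
apply: leeD; apply: ereal_sup_ge_mean.
- by exists a; [rewrite /= ger0_norm|exact: expectation_test].
- by exists (- a); [rewrite /= normrN ger0_norm|exact: expectation_test].
- by exists b; [rewrite /= ger0_norm|exact: expectation_test_onem].
- by exists (- b); [rewrite /= normrN ger0_norm|exact: expectation_test_onem].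
Qed.

End threshold_optimality.

Theorem proposition1 (R : realType) (kappa eps a b : R)
    (hkappa : 0 < kappa) (heps0 : 0 < eps) (heps1 : eps < 1)
    (ha : a = (1 - eps) * kappa) (hb : b = (1 + eps) * kappa) :
  exists c : R,
    unique (fun c' : R => 0 < c' /\
      expR (- b ^+ 2 / 2) * cosh (b * c') = expR (- a ^+ 2 / 2) * cosh (a * c')) c /\
    is_minimax kappa eps (threshold_test c) /\
    Rinf_star kappa eps =
      (Phi (a - c) + Phi (- a - c) + Phi (c - b) - Phi (- c - b))%:E.
Proof.
have a0 : 0 <= a by rewrite ha; nra.
have ab : a < b by rewrite ha hb; nra.
have b0 : 0 <= b by lra.
have [c c_gt0 eq_c] := mixture_lr_eq a b a0 ab.
have c0 := ltW c_gt0; have tT := threshold_test_is_test c c0.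
have minT : Rinf a b (threshold_test c) = Rinf_star kappa eps.
  rewrite /Rinf_star -ha -hb; apply/eqP; rewrite eq_le; apply/andP; split.
    by apply: le_ereal_inf_tmp => _ [phi tphi <-]; exact: Rinf_threshold_le.
  by apply: ereal_inf_lbound; exists (threshold_test c).
exists c; split; [split=> // d [d_gt0 eq_d]|split].
(* Equality at [x] forces strict inequality at any larger [y], so two distinct crossing points
   cannot coexist. *)
- have cross x y : 0 < x -> mixture_lr b x = mixture_lr a x ->
      mixture_lr b y = mixture_lr a y -> ~ x < y.
    move=> /ltW x0 ex ey xy.
    have := mixture_lr_cross a b x y a0 ab x0 xy.
    by rewrite ex ey lexx ltxx => /(_ isT).
  by case: (ltgtP c d) => // [/cross|/cross]; case.
- by split; rewrite -?ha -?hb.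
- rewrite -minT Rinf_threshold// !power_threshold//; congr EFin.
  (* The constant 1 of the type II error is absorbed by 1 - Phi(b - c) = Phi(c - b). *)
  by rewrite -(opprB b c) PhiN [- c - b]addrC; ring.
Qed.
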